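(* Let $k\ge 2$ and $1\le t<2^k-1$. Let $Z$ be the number of zeros in the $k$-bit cyclic word of $t$, and let $g_1,\ldots,g_Z$ be the numbers of ones between successive zeros of this cyclic word. Then $$|S_{t,k}|=2^{k-1}\quad\Longleftrightarrow\quad g_i\ge Z-1\ \text{ for every } 1\le i\le Z.$$
   Context: For an integer $n\ge0$, $\operatorname{wt}(n)$ is the number of ones in its binary expansion. For $k\ge2$, $N=2^k-1$ and $1\le t\le N-1$, $$S_{t,k}=\{(a,b)\in\{0,\ldots,N-1\}^2: a+b\equiv t \pmod N,\ \operatorname{wt}(a)+\operatorname{wt}(b)<k\}.$$ The $k$-bit word of $t$ is its binary expansion padded with zeros to length $k$; it is regarded as a cyclic word (indices modulo $k$). Since $1\le t<2^k-1$, it contains at least one zero and at least one one. The gaps $g_1,\dots,g_Z$ are the numbers of ones lying strictly between cyclically consecutive zeros (possibly $0$); so $g_1+\cdots+g_Z$ is the total number of ones. If $Z=1$ the unique gap is the total number of ones. Example: the cyclic word $0\,11\,0\,111\,0\,11$ has $Z=3$ and gaps $(2,3,2)$. *)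

(* Defs.v *)
From mathcomp Require Import all_boot.

Set Implicit Arguments.
Unset Strict Implicit.
Unset Printing Implicit Defensive.

Definition bit (n i : nat) : bool := odd (n %/ 2 ^ i).

(* The bits of index i >= n all vanish, because n < 2 ^ n. *)
Definition wt (n : nat) : nat := \sum_(i < n) bit n i.

Definition Stk (t k : nat) : {set 'I_(2 ^ k - 1) * 'I_(2 ^ k - 1)} :=
  [set ab : 'I_(2 ^ k - 1) * 'I_(2 ^ k - 1) |
     (ab.1 + ab.2 == t %[mod 2 ^ k - 1]) && (wt ab.1 + wt ab.2 < k)].

(* Least significant bit first: the opposite reading direction only reverses  *)
(* the cyclic order of the gaps.                                              *)
Definition word (k t : nat) : seq bool := mkseq (bit t) k.

Definition zeros (w : seq bool) : seq nat :=
  [seq i <- iota 0 (size w) | nth true w i == false].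

(* For a zero at position i, rot i.+1 w lists the cyclic word from position   *)
(* i + 1 on and ends with that zero, so the letters before its first false    *)
(* are those strictly between i and the cyclically next zero (which is i      *)
(* itself if w has only one zero).                                            *)
Definition gap (w : seq bool) (i : nat) : nat :=
  let s := rot i.+1 w in count_mem true (take (index false s) s).

Definition gaps (w : seq bool) : seq nat := [seq gap w i | i <- zeros w].

(* Main.v *)
(* Write b = t + c modulo 2^k - 1, where c is the complement of a, and let     *)
(* T, c be sets of bit positions and K the set of positions receiving a        *)
(* carry.  Then wt a + wt b = k + |T| - |K|, so one counts the c with          *)
(* |K| > |T|, that is, with R < N, where N = |K \ T| and R = |T \ K|.          *)
(* Given K, only the letters of c in the symmetric difference of K and T are   *)
(* constrained: N of them are 1 and R of them are 0.  If each letter is 1      *)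
(* with probability 1 - X, then P(N >= n) = (1 - X)^n B_n for a polynomial     *)
(* B_n, and a flip of one letter that takes N from below n to n or more        *)
(* happens on cylinders with exactly n - 1 prescribed ones.  Hence Russo's     *)
(* formula for the derivative reads (n + s) b_s - (s + 1) b_(s+1) = f_(n,s)    *)
(* for the coefficients of B_n, where f_(n,s) >= 0 counts pivotal cylinders.   *)
(* At X = 1/2 the counts telescope, which gives                                *)
(*   |S| = 2^(k-1) + [|T| < Z] - 2^k sum_n 2^(1-2n) f_(n,n-2) / (n - 1).       *)
(* If all gaps are at least Z - 1 there is no pivotal cylinder in the sum and  *)
(* |T| >= Z; otherwise explicit pivotal cylinders make the sum exceed the      *)
(* bracket.                                                                    *)

Require Import Defs.
From mathcomp Require Import all_boot.
From mathcomp Require Import all_order all_algebra.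
From mathcomp Require Import zify ring lra.

Set Implicit Arguments.
Unset Strict Implicit.
Unset Printing Implicit Defensive.

Import Order.TTheory GRing.Theory Num.Theory.

(** * Cyclic carries and the effect of flipping one letter *)

(** Addition modulo [2 ^ k - 1] is binary addition with an end-around carry. A pair [(a, b)] is
    recorded by the complement [c] of [a], so that [b = t + c]; counting bits compares [#|K|] with
    [#|T|] for the carry set [K] ([Stk_pair]). Thus [Stk] corresponds to [heavy T] together with the
    single set [~: T], which stands for the pair [(t, 0)] ([card_Stk]).

    The [c] for which an admissible [K] solves the carry equations form a cylinder with [hits]
    prescribed ones and [misses] prescribed zeros ([carry_sol_cylinder], [weight_sol]), and
    [#|T| < #|K|] reads [misses < hits]. With weight [1 - X] for a one and [X] for a zero, this
    inequality becomes a truncation of polynomials ([heavy_sum]). The levels are differences of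
    tails, so the truncated values at 1/2 telescope, leaving two neighbouring coefficients of each
    tail ([trunc_half_telescope]); Russo's formula expresses exactly that combination by pivotal
    flips ([tail_poly_coef]).

    The resulting identity [heavy_formula] is exact, with nonnegative [deficit] terms. Long gaps
    force so many misses that every deficit vanishes ([long_gaps_misses]). A short gap yields a
    flippable carry set ([short_gap_flip]) unless [T] has too few ones, and then [set0] already
    makes the deficits too large ([flip_count_ge]). *)

Section Carries.

Variable p : nat.
Local Notation I := 'I_p.+2.
Implicit Types (T c K A : {set I}) (i v : I).

Local Open Scope ring_scope.

Definition maj (x y z : bool) := (x && y) || (z && (x || y)).

Definition carry_step T c K : {set I} :=
  [set i : I | maj (i - 1 \in K) (i - 1 \in T) (i - 1 \in c)].

(* Least fixpoint: for c = ~: T both set0 and setT are fixpoints, otherwise    *)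
(* there is only one (carry_sol_neq).                                          *)
Definition carry T c : {set I} := fixset (carry_step T c).

Definition carry_sol T c K := carry_step T c K == K.

(** These are the positions where the outgoing carry depends on the letter of [c]; elsewhere it is
    the common value of [K] and [T]. *)
Definition read_bits T K : {set I} := [set i : I | (i \in K) != (i \in T)].

(* Steps forward from [v + 1] to [i], so that [dist v v] is maximal.           *)
Definition dist v i : nat := (i - v - 1)%R.

Definition window v (a : nat) : {set I} := [set i : I | (dist v i < a)%N].

Lemma maj_mono x y z x' z' : (x ==> x') -> (z ==> z') -> maj x y z -> maj x' y z'.
Proof. by case: x; case: y; case: z; case: x'; case: z'. Qed.

Lemma carry_step_mono T c c' K K' :
  c \subset c' -> K \subset K' -> carry_step T c K \subset carry_step T c' K'.
Proof.
move=> /subsetP sc /subsetP sK; apply/subsetP=> i; rewrite !inE.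
by apply: maj_mono; apply/implyP; [apply: sK | apply: sc].
Qed.

Lemma carryK T c : carry_step T c (carry T c) = carry T c.
Proof. by apply: fixsetK => A B; apply: carry_step_mono. Qed.

Lemma carry_solP T c K :
  reflect (forall i, (i + 1 \in K) = maj (i \in K) (i \in T) (i \in c))
          (carry_sol T c K).
Proof.
apply: (iffP eqP) => [solK i | solK]; first by rewrite -{1}solK inE addrK.
by apply/setP=> i; rewrite inE -solK subrK.
Qed.

Lemma carry_sol_carry T c : carry_sol T c (carry T c).
Proof. by apply/eqP/carryK. Qed.

Lemma carry_least T c K : carry_step T c K \subset K -> carry T c \subset K.
Proof.
move=> preK; rewrite /carry /fixset.
elim: #|_| => [|m IHm] /=; first exact: sub0set.
by apply: subset_trans preK; apply: carry_step_mono.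
Qed.

Lemma carry_mono T c c' : c \subset c' -> carry T c \subset carry T c'.
Proof.
move=> scc'; apply: carry_least; rewrite -{2}carryK.
exact: carry_step_mono.
Qed.

Lemma val_addr1 (x : I) : (x + 1)%R = (if x == -1 then 0%N else x.+1) :> nat.
Proof.
case: eqP => [-> | nx]; first by rewrite addNr.
have lt_x : (x.+1 < p.+2)%N.
  rewrite ltn_neqAle ltn_ord andbT; apply/eqP => ex; apply: nx.
  apply/eqP; rewrite -subr_eq0 opprK; apply/eqP/val_inj => /=.
  by rewrite (modn_small (_ : 1 < p.+2)%N) // addn1 ex modnn.
by rewrite /= (modn_small (_ : 1 < p.+2)%N) // addn1 modn_small.
Qed.

Lemma dist_lt v i : (dist v i < p.+2)%N.
Proof. exact: ltn_ord. Qed.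

Lemma dist_inj v : injective (dist v).
Proof. by move=> i j /val_inj /addIr /addIr. Qed.

Lemma dist_add1 v i : dist v (i + 1) = (if i == v then 0%N else (dist v i).+1).
Proof.
have e : (i - v - 1 == -1) = (i == v) by rewrite addrC -subr_eq0 opprK addrAC addNr add0r subr_eq0.
rewrite /dist (_ : i + 1 - v - 1 = i - v - 1 + 1); last by ring.
by rewrite val_addr1 e.
Qed.

Lemma dist_eq0 v i : (dist v i == 0%N) = (i == v + 1).
Proof.
have d0 : dist v (v + 1) = 0%N by rewrite dist_add1 eqxx.
by rewrite -d0 (inj_eq (@dist_inj v)).
Qed.

Lemma dist_pred v i : i != v + 1 -> dist v i = (dist v (i - 1)).+1.
Proof.
move=> ni; rewrite -{1}(subrK 1 i) dist_add1 ifF //.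
by apply/negP=> /eqP ei; case/negP: ni; rewrite -ei subrK.
Qed.

Lemma dist_surj v (a : nat) : (a < p.+2)%N -> exists i, dist v i = a.
Proof.
move=> lt_a; exists (Ordinal lt_a + 1 + v); rewrite /dist.
by rewrite addrK addrK.
Qed.

Lemma dist_self v : dist v v = p.+1.
Proof.
have [i di] := dist_surj v (ltnSn p.+1).
case: (eqVneq i v) di => [-> // | niv di].
by have := dist_lt v (i + 1); rewrite dist_add1 (negbTE niv) di ltnn.
Qed.

Lemma window_full v : window v p.+2 = setT.
Proof. by apply/setP=> i; rewrite !inE dist_lt. Qed.

Lemma window_mono v a b : (a <= b)%N -> window v a \subset window v b.
Proof. by move=> le_ab; apply/subsetP => i; rewrite !inE => /leq_trans; apply. Qed.

Definition zeros_in T v a := #|window v a :\: T|.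

Lemma zeros_in0 T v : zeros_in T v 0 = 0%N.
Proof. by apply/eqP; rewrite cards_eq0; apply/eqP/setP=> i; rewrite !inE ltn0 andbF. Qed.

Lemma zeros_in_full T v : zeros_in T v p.+2 = #|~: T|.
Proof. by rewrite /zeros_in window_full setTD. Qed.

Lemma zeros_in_mono T v a b : (a <= b)%N -> (zeros_in T v a <= zeros_in T v b)%N.
Proof. by move=> le_ab; apply: subset_leq_card; apply/setSD/window_mono. Qed.

Lemma zeros_inS T v a : (zeros_in T v a.+1 <= (zeros_in T v a).+1)%N.
Proof.
have [lt_a | le_a] := ltnP a p.+2; last first.
  apply: leqW; apply: subset_leq_card; apply: setSD; apply/subsetP => i _.
  by rewrite !inE; exact (leq_trans (dist_lt v i) le_a).
have [i di] := dist_surj v lt_a.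
rewrite -[X in (_ <= X)%N]add1n -(cards1 i).
have [le_card _] := leq_card_setU [set i] (window v a :\: T).
apply: leq_trans le_card.
apply: subset_leq_card; apply/subsetP=> j; rewrite !inE ltnS leq_eqVlt -di.
by rewrite (inj_eq (@dist_inj v)); case/andP=> -> /orP[-> // | ->]; rewrite orbT.
Qed.

(** Distance at which the [r]-th zero of [T] after [v] has just been included. The search range
    [0..p.+2] ends with the full cycle. *)
Definition reach T v r := find (fun a => r <= zeros_in T v a)%N (iota 0 p.+3).

Section Reach.

Variables (T : {set I}) (v : I) (r : nat).
Hypothesis le_r : (r <= #|~: T|)%N.

Let has_reach : has (fun a => r <= zeros_in T v a)%N (iota 0 p.+3).
Proof.
apply/(has_nthP 0%N); exists p.+2; rewrite ?size_iota // nth_iota // add0n.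
by rewrite zeros_in_full.
Qed.

Lemma reach_le : (reach T v r <= p.+2)%N.
Proof. by have := has_reach; rewrite has_find size_iota. Qed.

Lemma reachP : (r <= zeros_in T v (reach T v r))%N.
Proof.
have := nth_find 0%N has_reach; rewrite -/(reach T v r) nth_iota ?add0n //.
exact: leq_ltn_trans reach_le _.
Qed.

Lemma reach_min a : (a < reach T v r)%N -> (zeros_in T v a < r)%N.
Proof.
move=> lt_a; have := before_find 0%N lt_a.
rewrite nth_iota ?add0n; last by apply: leq_trans lt_a _; apply: leq_trans reach_le _.
by rewrite ltnNge => ->.
Qed.

Lemma reach_gt0 : (0 < r)%N -> (0 < reach T v r)%N.
Proof.
move=> r_gt0; rewrite lt0n; apply/negP => /eqP e0.
by have := reachP; rewrite e0 zeros_in0 leqNgt r_gt0.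
Qed.

Lemma zeros_before_reach : (0 < r)%N -> zeros_in T v (reach T v r).-1 = r.-1.
Proof.
move=> r_gt0; have e_gt0 := reach_gt0 r_gt0.
have lt_e : ((reach T v r).-1 < reach T v r)%N by rewrite prednK.
have := zeros_inS T v (reach T v r).-1; rewrite prednK // => leS.
by have := reach_min lt_e; have := leq_trans reachP leS; lia.
Qed.

End Reach.

Definition hits T K := #|K :\: T|.
Definition misses T K := #|T :\: K|.

Lemma hits_le T K : (hits T K <= #|~: T|)%N.
Proof. by apply: subset_leq_card; apply/subsetP => i; rewrite !inE => /andP[]. Qed.

Lemma hits_mono T K K' : K \subset K' -> (hits T K <= hits T K')%N.
Proof. by move=> sK; apply: subset_leq_card; apply: setSD. Qed.

Lemma hitsU T K A : (hits T (K :|: A) <= hits T K + #|A :\: T|)%N.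
Proof. by rewrite /hits setDUl; have [] := leq_card_setU (K :\: T) (A :\: T). Qed.

Lemma hitsU_disjoint T K A :
  [disjoint K & A] -> hits T (K :|: A) = (hits T K + #|A :\: T|)%N.
Proof.
move=> dKA; rewrite /hits setDUl; apply/eqP.
have [_ ->] := leq_card_setU (K :\: T) (A :\: T).
by apply: disjointWl (subsetDl _ _) _; apply: disjointWr (subsetDl _ _) _.
Qed.

Section Flip.

Variables (T c : {set I}) (v : I).
Hypothesis vc : v \notin c.
Let K := carry T c.

Let solK i : (i + 1 \in K) = maj (i \in K) (i \in T) (i \in c).
Proof. by move: i; apply/carry_solP/carry_sol_carry. Qed.

Lemma flip_locked : v \notin read_bits T K -> carry T (v |: c) = K.
Proof.
rewrite inE negbK => /eqP vKT; apply/eqP; rewrite eqEsubset andbC.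
rewrite carry_mono ?subsetUr //=; apply: carry_least.
rewrite (_ : carry_step _ _ _ = K) //; apply/eqP/carry_solP => i.
rewrite solK !inE; case: eqP => [-> | //].
by rewrite vKT (negbTE vc) /maj; case: (v \in T).
Qed.

Lemma succ_read_notin : v \in read_bits T K -> v + 1 \notin K.
Proof.
by rewrite inE solK (negbTE vc) /maj; case: (v \in K); case: (v \in T).
Qed.

(** The carry launched at [v] is passed on wherever [T] or [c] has a one. The last position of the
    window only has to receive it, hence [e.-1]. *)
Lemma flip_window e : (forall i, i \in window v e.-1 -> (i \in T) || (i \in c)) ->
  v \in read_bits T K -> window v e \subset carry T (v |: c).
Proof.
move=> arcTc vD; have solK1 := carry_solP _ _ _ (carry_sol_carry T (v |: c)).
have sK : K \subset carry T (v |: c) by rewrite carry_mono ?subsetUr.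
suff main h i : dist v i = h -> (h < e)%N -> i \in carry T (v |: c).
  by apply/subsetP => i; rewrite inE; apply: main.
elim: h i => [|h IHh] i di lt_h.
  have -> : i = v + 1 by apply/eqP; rewrite -dist_eq0 di.
  rewrite solK1 setU11; move: vD; rewrite inE /maj.
  case: (boolP (v \in K)) => [/(subsetP sK) -> /= | _ /=]; first by rewrite orbT.
  by move=> /eqP; case: (v \in T) => // _; rewrite orbT orbT.
have ni : i != v + 1 by rewrite -dist_eq0 di.
have di1 : dist v (i - 1) = h by apply/eqP; rewrite -eqSS -dist_pred // di.
have iK : i - 1 \in carry T (v |: c) by apply: IHh (ltnW lt_h).
have := arcTc (i - 1); rewrite inE di1 => /(_ ltac:(lia)) TcI.
rewrite -(subrK 1 i) solK1 iK /maj /= !inE andbT.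
by case/orP: TcI => -> //; rewrite !orbT.
Qed.

(* The carries of [v |: c] cannot go past an obstruction met at distance [h]. *)
Lemma flip_bound h x : v \in read_bits T K -> (0 < h < p.+2)%N ->
    (dist v x = h /\ x \in K) \/ (dist v x = h.-1 /\ x \notin T :|: c) ->
  carry T (v |: c) \subset K :|: window v h.
Proof.
move=> vD /andP[h_gt0 lt_h] obs; apply: carry_least; apply/subsetP => j.
rewrite -(subrK 1 j); set i := j - 1; rewrite inE addrK.
have [-> _ | niv] := eqVneq i v; first by rewrite !inE dist_add1 eqxx h_gt0 orbT.
rewrite !inE (negbTE niv) /= dist_add1 (negbTE niv).
have [lt_i | le_i] := ltnP (dist v i) h; last by rewrite orbF -solK => ->.
rewrite orbT => maji; move: lt_i; rewrite leq_eqVlt => /orP[/eqP ei | ->]; last by rewrite orbT.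
case: obs => [[dx xK] | [dx]].
  suff -> : i + 1 = x by rewrite xK.
  by apply: (@dist_inj v); rewrite dist_add1 (negbTE niv) ei dx.
have -> : x = i by apply: (@dist_inj v); rewrite dx -ei.
by rewrite inE negb_or => /andP[/negbTE nT /negbTE nc]; move: maji; rewrite nT nc /maj andbF.
Qed.

(** The flip launches a carry at [v + 1], which gains one hit at each zero of [T] it reaches, until
    it meets an old carry or a position where [T] and [c] both vanish. To gain the missing
    [r = n - hits T K] hits it must reach the [r]-th zero after [v], and for this [c] needs ones
    only at the [r - 1] zeros before it. *)
Lemma flip_hits n : (hits T K < n <= #|~: T|)%N ->
  (n <= hits T (carry T (v |: c)))%N =
  [&& v \in read_bits T K, [disjoint K & window v (reach T v (n - hits T K))] &
      window v (reach T v (n - hits T K)).-1 :\: T \subset c].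
Proof.
case/andP=> lt_n le_n; set r := (n - hits T K)%N; set e := reach T v r.
have r_gt0 : (0 < r)%N by rewrite subn_gt0.
have le_r : (r <= #|~: T|)%N by apply: leq_trans (leq_subr _ _) le_n.
have e_le : (e <= p.+2)%N := reach_le v le_r.
have e_gt0 : (0 < e)%N := reach_gt0 v le_r r_gt0.
have [vD | /flip_locked -> /=] := boolP (v \in read_bits T K); last first.
  by apply/negbTE; rewrite -ltnNge.
(* An obstruction before distance [e] confines the new carries to a window with fewer than [r]
   zeros. *)
have bound h x : (0 < h < e)%N ->
    (dist v x = h /\ x \in K) \/ (dist v x = h.-1 /\ x \notin T :|: c) ->
    (n <= hits T (carry T (v |: c)))%N = false.
  case/andP=> h_gt0 lt_h obs; apply/negbTE; rewrite -ltnNge.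
  have sb := flip_bound vD (_ : 0 < h < p.+2)%N obs.
  have {}sb := sb ltac:(by rewrite h_gt0 (leq_trans lt_h)).
  apply: leq_ltn_trans (hits_mono T sb) _.
  apply: leq_ltn_trans (hitsU T K _) _.
  by have := reach_min le_r lt_h; rewrite /zeros_in /r; lia.
rewrite /=; apply/idP/andP => [le_hits | [dis sub]].
  split.
    rewrite disjoints_subset; apply/subsetP => i iK; rewrite !inE -leqNgt leqNgt.
    apply/negP => lt_i; move: le_hits; rewrite (bound (dist v i) i) //; last by left.
    rewrite lt_i andbT lt0n dist_eq0; apply/eqP => ei.
    by move: (succ_read_notin vD); rewrite -ei iK.
  apply/subsetP => i; rewrite !inE => /andP[nT lt_i].
  apply/negPn/negP => nc; move: le_hits; rewrite (bound (dist v i).+1 i) //.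
    by rewrite /= -ltn_predRL.
  by right; rewrite inE negb_or nT nc.
have sK : K \subset carry T (v |: c) by rewrite carry_mono ?subsetUr.
have sA : window v e \subset carry T (v |: c).
  apply: flip_window => // i iA; case: (boolP (i \in T)) => //= nT.
  by apply: (subsetP sub); rewrite inE nT.
have sU : K :|: window v e \subset carry T (v |: c) by rewrite subUset sK.
apply: leq_trans (hits_mono T sU); rewrite hitsU_disjoint //.
by have := reachP v le_r; rewrite /zeros_in -/e /r; lia.
Qed.

End Flip.

(** A disagreement at [i + 1] forces one at [i], and there [c] and [T] have opposite letters. Going
    backwards around the cycle, it spreads to every position. *)
Lemma carry_sol_neq T c K K' : carry_sol T c K -> carry_sol T c K' -> K != K' ->
  c = ~: T /\ K' = ~: K.
Proof.
move=> /carry_solP solK /carry_solP solK' neq.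
have step i : (i + 1 \in K) != (i + 1 \in K') ->
    ((i \in K) != (i \in K')) && ((i \in c) != (i \in T)).
  rewrite solK solK' /maj.
  by case: (i \in K); case: (i \in K'); case: (i \in T); case: (i \in c).
have [i0 ni0] : exists i, (i \in K) != (i \in K').
  apply/existsP; apply: contraR neq; rewrite negb_exists => /forallP eqK.
  by apply/eqP/setP => i; apply/eqP/negPn; apply: eqK.
have all_neq i : (i \in K) != (i \in K').
  have [m] := ubnP (p.+2 - dist i0 i); elim: m i => // m IHm i lt_m.
  have [-> // | nii0] := eqVneq i i0.
  have := IHm (i + 1); rewrite dist_add1 (negbTE nii0) => /(_ ltac:(have := dist_lt i0 i; lia)).
  by case/step/andP.
split; apply/setP => i; rewrite inE.
  by have := step i (all_neq _) => /andP[_]; case: (i \in c); case: (i \in T).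
by have := all_neq i; case: (i \in K); case: (i \in K').
Qed.

End Carries.

(** * Weights of carry fibres *)

Section Weights.

Variable p : nat.
Local Notation I := 'I_p.+2.
Variable T : {set I}.
Implicit Types (c K A : {set I}) (i v : I).

Local Open Scope ring_scope.

Definition admissible K :=
  [forall i, ((i \in K) == (i \in T)) ==> ((i + 1 \in K) == (i \in T))].

Lemma carry_sol_cylinder c K : carry_sol T c K =
  admissible K && [forall i, (i \in read_bits T K) ==> ((i \in c) == (i + 1 \in K))].
Proof.
apply/carry_solP/andP => [solK | [/forallP adK /forallP cK] i].
  split; apply/forallP => i; rewrite ?inE solK /maj.
    by case: (i \in K); case: (i \in T); case: (i \in c).
  by case: (i \in K); case: (i \in T); case: (i \in c).
have := adK i; have := cK i; rewrite inE /maj.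
by case: (i \in K); case: (i \in T); case: (i \in c); case: (i + 1 \in K).
Qed.

(** The positions with a carry at their successor number [#|K|]; those among them that are not read
    form [K :&: T]. *)
Lemma read_hits K : admissible K ->
  #|[set i in read_bits T K | i + 1 \in K]| = hits T K.
Proof.
move=> /forallP adK; have shiftK : #|[set i | i + 1 \in K]| = #|K|.
  rewrite -(card_imset (mem K) (@subIr _ 1)); congr #|pred_of_set _|.
  apply/setP=> i; rewrite inE; apply/idP/imsetP => [iK | [j jK ->]].
    by exists (i + 1); rewrite ?addrK.
  by rewrite subrK.
have -> : [set i in read_bits T K | i + 1 \in K] = [set i | i + 1 \in K] :\: (K :&: T).
  apply/setP=> i; rewrite !inE; have := adK i.
  by case: (i \in K); case: (i \in T); case: (i + 1 \in K).
rewrite cardsDS ?shiftK; first by rewrite /hits -(cardsID T K) addKn.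
apply/subsetP=> i; rewrite !inE => /andP[iK iT]; have := adK i.
by rewrite iK iT => /eqP ->.
Qed.

Lemma card_read_bits K : #|read_bits T K| = (hits T K + misses T K)%N.
Proof.
have -> : read_bits T K = (K :\: T) :|: (T :\: K).
  by apply/setP=> i; rewrite !inE; case: (i \in K); case: (i \in T).
apply/eqP; have [_ ->] := leq_card_setU (K :\: T) (T :\: K).
by rewrite -setI_eq0; apply/eqP/setP=> i; rewrite !inE; case: (i \in K); rewrite ?andbF.
Qed.

Lemma read_misses K : admissible K ->
  #|[set i in read_bits T K | i + 1 \notin K]| = misses T K.
Proof.
move=> adK; apply: (@addnI (hits T K)); rewrite -card_read_bits -{1}read_hits //.
rewrite -(cardsID [set i | i + 1 \in K] (read_bits T K)).
by congr (_ + _)%N; apply: eq_card => i; rewrite !inE // andbC.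
Qed.

(** Ones have probability [1 - X], so that prescribed zeros appear as powers of [X] and a bound on
    [misses] becomes a bound on degrees. *)
Definition letter (b : bool) : {poly rat} := if b then 1 - 'X else 'X.

Definition weight c := \prod_i letter (i \in c).

Definition weight_off v c := \prod_(i | i != v) letter (i \in c).

Lemma letterD : letter true + letter false = 1.
Proof. by rewrite /letter subrK. Qed.

Lemma sum_cylinder (ok : I -> bool -> bool) (F : I -> bool -> {poly rat}) :
  \sum_(c : {set I} | [forall i, ok i (i \in c)]) \prod_i F i (i \in c) =
  \prod_i ((if ok i true then F i true else 0) + (if ok i false then F i false else 0)).
Proof.
rewrite bigA_distr big_mkcond /=; apply: eq_bigr => c _.
case: forallP => [okc | /forallP].
  by apply: eq_bigr => i _; have := okc i; case: (i \in c) => ->.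
rewrite negb_forall => /existsP[i /negbTE nok]; rewrite (bigD1 i) //=.
by move: nok; case: (i \in c) => ->; rewrite mul0r.
Qed.

Lemma prod_if_const A (x : {poly rat}) :
  \prod_i (if i \in A then x else 1) = x ^+ #|A|.
Proof. by rewrite -big_mkcond prodr_const. Qed.

Lemma weight_sol K : admissible K ->
  \sum_(c : {set I} | carry_sol T c K) weight c = (1 - 'X) ^+ hits T K * 'X^(misses T K).
Proof.
move=> adK; rewrite (eq_bigl (fun c : {set I} =>
    [forall i, (i \in read_bits T K) ==> ((i \in c) == (i + 1 \in K))])); last first.
  by move=> c; rewrite carry_sol_cylinder adK.
rewrite (sum_cylinder (fun i b => (i \in read_bits T K) ==> (b == (i + 1 \in K)))
  (fun _ b => letter b)).
rewrite -read_hits // -read_misses // -!prod_if_const -big_split /=.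
apply: eq_bigr => i _; rewrite /letter !inE.
case: ((i \in K) != (i \in T)) => /=; last by rewrite mulr1 subrK.
by case: (i + 1 \in K); rewrite ?mulr1 ?mul1r ?addr0 ?add0r.
Qed.

Lemma carry_compl : carry T (~: T) = set0.
Proof.
apply/eqP; rewrite -subset0; apply: carry_least; apply/subsetP=> i.
by rewrite !inE /maj; case: (i - 1 \in T).
Qed.

Lemma carry_eq c K : K != setT -> (carry T c == K) = carry_sol T c K.
Proof.
move=> nK; apply/eqP/idP => [<- | solK]; first exact: carry_sol_carry.
apply/eqP; apply: contraR nK => neq.
have [ec ->] := carry_sol_neq (carry_sol_carry T c) solK neq.
by rewrite ec carry_compl setC0.
Qed.

Lemma carry_eqT c : (carry T c == setT) = carry_sol T c setT && (c != ~: T).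
Proof.
apply/eqP/andP => [eT | [solT nc]].
  split; first by rewrite -eT carry_sol_carry.
  apply/eqP => ec; move: eT; rewrite ec carry_compl => /setP/(_ 0).
  by rewrite !inE.
apply/eqP; apply: contraR nc => neq.
by have [->] := carry_sol_neq (carry_sol_carry T c) solT neq.
Qed.

Lemma admissibleT : admissible setT.
Proof. by apply/forallP => i; rewrite !inE; case: (i \in T). Qed.

Lemma hitsT : hits T setT = #|~: T|.
Proof. by rewrite /hits setTD. Qed.

Lemma missesT : misses T setT = 0%N.
Proof. by rewrite /misses setDT cards0. Qed.

Lemma sum_carry_eq K (F : {set I} -> {poly rat}) : K != setT ->
  \sum_(c : {set I} | carry T c == K) F c = \sum_(c : {set I} | carry_sol T c K) F c.
Proof. by move=> nK; apply: eq_bigl => c; apply: carry_eq. Qed.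

Lemma sum_sol_inadmissible K (F : {set I} -> {poly rat}) : ~~ admissible K ->
  \sum_(c : {set I} | carry_sol T c K) F c = 0.
Proof. by move=> nad; apply: big_pred0 => c; rewrite carry_sol_cylinder (negbTE nad). Qed.

Lemma weight_carryT :
  \sum_(c : {set I} | carry T c == setT) weight c = (1 - 'X) ^+ #|~: T| * (1 - 'X^#|T|).
Proof.
have := weight_sol admissibleT; rewrite hitsT missesT expr0 mulr1.
rewrite (bigD1 (~: T)) /=; last first.
  by apply/carry_solP => i; rewrite !inE /maj; case: (i \in T).
rewrite (eq_bigl (fun c => carry T c == setT)) => [|c]; last by rewrite carry_eqT.
move=> /(canRL (addKr _)) ->; rewrite mulrBr mulr1 addrC; congr (_ - _).
rewrite /weight (bigID (mem T)) /= mulrC; congr (_ * _).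
  rewrite (eq_bigr (fun _ => 1 - 'X)) => [|i nT]; last by rewrite inE nT.
  by rewrite prodr_const; congr (_ ^+ _); apply: eq_card => i; rewrite !inE.
rewrite (eq_bigr (fun _ => 'X)) => [|i iT]; last by rewrite inE iT.
by rewrite prodr_const.
Qed.

(* The last summand belongs to the carry set setT, whose fibre is a cylinder   *)
(* without the point ~: T.                                                     *)
Definition level_poly (n : nat) : {poly rat} :=
  \sum_(K : {set I} | [&& admissible K, K != setT & hits T K == n]) 'X^(misses T K) +
  (if n == #|~: T| then 1 - 'X^#|T| else 0).

Definition tail_poly (n : nat) : {poly rat} :=
  \sum_(n <= m < #|~: T|.+1) (1 - 'X) ^+ (m - n) * level_poly m.

Lemma weight_level n :
  \sum_(c : {set I} | hits T (carry T c) == n) weight c = (1 - 'X) ^+ n * level_poly n.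
Proof.
rewrite (partition_big (carry T) predT) //= (bigD1 setT) //= addrC /level_poly mulrDr.
congr (_ + _); last first.
  rewrite (eq_bigl (fun c => (hits T setT == n) && (carry T c == setT))); last first.
    by move=> c; case: (carry T c =P setT) => [-> | _]; rewrite ?andbF ?andbT.
  rewrite hitsT eq_sym; case: eqP => [-> | _] /=; last by rewrite big_pred0_eq mulr0.
  exact: weight_carryT.
rewrite mulr_sumr [RHS]big_mkcond [LHS]big_mkcond /=; apply: eq_bigr => K _.
have [nK /= | _ /=] := boolP (K != setT); last by rewrite andbF.
rewrite (eq_bigl (fun c => (hits T K == n) && (carry T c == K))); last first.
  by move=> c; case: (carry T c =P K) => [-> | _]; rewrite ?andbF ?andbT.
case: eqP => [<- | _] /=; last by rewrite big_pred0_eq andbF.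
rewrite andbT sum_carry_eq //; case: ifP => [adK | /negbT nad]; first exact: weight_sol.
exact: sum_sol_inadmissible.
Qed.

Lemma weight_tail n :
  \sum_(c : {set I} | (n <= hits T (carry T c))%N) weight c = (1 - 'X) ^+ n * tail_poly n.
Proof.
rewrite /tail_poly mulr_sumr big_nat_cond.
rewrite (eq_bigr (fun m => \sum_(c : {set I} | hits T (carry T c) == m) weight c)); last first.
  move=> m /andP[/andP[le_nm _] _].
  by rewrite weight_level mulrA -exprD subnKC.
rewrite -big_nat_cond; under [RHS]eq_bigr do rewrite big_mkcond.
rewrite exchange_big /= [LHS]big_mkcond; apply: eq_bigr => c _.
rewrite -big_mkcond (eq_bigl (fun m => m == hits T (carry T c))) => [|m]; last exact: eq_sym.
by rewrite big_nat1_eq ltnS hits_le andbT.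
Qed.

End Weights.

(** * Pivotal cylinders and Russo's formula *)

Lemma deriv_prod_seq (R : comNzRingType) (J : eqType) (s : seq J) (f : J -> {poly R}) :
  uniq s -> ((\prod_(i <- s) f i)^`() =
    \sum_(v <- s) (f v)^`() * \prod_(i <- s | i != v) f i)%R.
Proof.
elim: s => [|x s IHs] /=; first by rewrite !big_nil derivC.
case/andP=> xs us; rewrite !big_cons derivM IHs // eqxx /=; congr (_ * _ + _)%R.
  rewrite big_seq [RHS]big_seq_cond; apply: eq_bigl => i.
  by case: (boolP (i \in s)) => //= iS; apply/esym; apply: contraNneq xs => <-.
rewrite mulr_sumr [LHS]big_seq [RHS]big_seq; apply: eq_bigr => v vs.
rewrite big_cons ifT; first by rewrite mulrCA.
by apply: contraNneq xs => ->.
Qed.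

Lemma deriv_prod (R : comNzRingType) (J : finType) (f : J -> {poly R}) :
  ((\prod_i f i)^`() = \sum_v (f v)^`() * \prod_(i | i != v) f i)%R.
Proof. exact/deriv_prod_seq/index_enum_uniq. Qed.

Section Russo.

Variable p : nat.
Local Notation I := 'I_p.+2.
Variable T : {set I}.
Implicit Types (c K A : {set I}) (i v : I).

Local Open Scope ring_scope.

(** The conditions of [flip_hits] that concern [K] alone; the remaining one prescribes letters of
    [c]. *)
Definition flippable n v K :=
  [&& admissible T K, (hits T K < n)%N, v \in read_bits T K &
      [disjoint K & window v (reach T v (n - hits T K))]].

Definition flip_poly n : {poly rat} :=
  \sum_v \sum_(K : {set I} | flippable n v K) 'X^((misses T K).-1).

Section Cylinder.

Variables (n : nat) (v : I) (K : {set I}).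
Hypotheses (le_n : (n <= #|~: T|)%N) (flipK : flippable n v K).

Let r := (n - hits T K)%N.
Let Y := window v (reach T v r).-1 :\: T.

Let r_gt0 : (0 < r)%N.
Proof. by have/and4P[_ lt_n _ _] := flipK; rewrite subn_gt0. Qed.

Let le_r : (r <= #|~: T|)%N.
Proof. exact: leq_trans (leq_subr _ _) le_n. Qed.

Lemma flippable_succ : v + 1 \notin K.
Proof.
have/and4P[_ _ _ dis] := flipK; rewrite disjoint_sym in dis.
rewrite (disjointFr dis) // inE dist_add1 eqxx; exact: reach_gt0.
Qed.

Let Y_locked i : i \in Y -> (i \notin K) && (i \notin T).
Proof.
have/and4P[_ _ _ dis] := flipK; rewrite disjoint_sym in dis.
rewrite !inE => /andP[-> lt_i]; rewrite andbT (disjointFr dis) // inE.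
by apply: leq_trans lt_i _; apply: leq_pred.
Qed.

(** To the [hits] ones read by [K], the set [Y] adds [r - 1] further prescribed ones; [Y] meets
    neither [K] nor [T], so no letter counts twice and the total is [n - 1]. The letter at [v] is a
    read zero, and omitting it lowers the exponent of [X] by one. *)
Lemma weight_off_cylinder :
  \sum_(c : {set I} | [&& v \notin c, carry_sol T c K & Y \subset c]) weight_off v c =
  (1 - 'X) ^+ n.-1 * 'X^((misses T K).-1).
Proof.
have/and4P[adK lt_n vD dis] := flipK.
have cardY : #|Y| = r.-1 := zeros_before_reach v le_r r_gt0.
clearbody Y.
pose ok i b := [&& (i \in read_bits T K) ==> (b == (i + 1 \in K)),
                   (i == v) ==> ~~ b & (i \in Y) ==> b].
pose F i b := if i == v then 1 else letter b.
have -> : \sum_(c : {set I} | [&& v \notin c, carry_sol T c K & Y \subset c]) weight_off v c =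
    \sum_(c : {set I} | [forall i, ok i (i \in c)]) \prod_i F i (i \in c).
  apply: eq_big => [c | c _]; last first.
    rewrite /weight_off big_mkcond /=; apply: eq_bigr => i _.
    by rewrite /F; case: (i == v).
  rewrite carry_sol_cylinder adK /=; apply/and3P/forallP => [[vc /forallP cK /subsetP Yc] i | okc].
    rewrite /ok cK /=; apply/andP; split; apply/implyP; last exact: Yc.
    by move/eqP=> ->.
  split; first by have := okc v; rewrite /ok eqxx => /and3P[].
    by apply/forallP => i; have /and3P[] := okc i.
  by apply/subsetP => i iY; have /and3P[_ _] := okc i; rewrite iY.
rewrite sum_cylinder.
pose D1 := [set i in read_bits T K | i + 1 \in K].
pose D0 := [set i in read_bits T K | i + 1 \notin K] :\ v.
have -> : 'X^((misses T K).-1) = \prod_i (if i \in D0 then 'X else 1) :> {poly rat}.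
  rewrite prod_if_const -read_misses // [in LHS](cardsD1 v).
  by move: vD; rewrite !inE flippable_succ andbT => ->.
have -> : (1 - 'X) ^+ n.-1 = (\prod_i (if i \in D1 then 1 - 'X else 1)) *
    (\prod_i (if i \in Y then 1 - 'X else 1)) :> {poly rat}.
  rewrite !prod_if_const -exprD read_hits //; congr (_ ^+ _).
  by rewrite cardY; move: r_gt0; rewrite /r; lia.
rewrite -!big_split /=.
apply: eq_bigr => i _; rewrite /F /ok !inE.
have [-> | niv] := eqVneq i v.
  have -> : v \in Y = false.
    apply/negP => /Y_locked /andP[/negbTE vK /negbTE vT].
    by move: vD; rewrite inE vK vT.
  by move: vD; rewrite inE (negbTE flippable_succ) /= => ->; rewrite /= !mulr1 add0r.
case: (boolP (i \in Y)) => [/Y_locked /andP[/negbTE -> /negbTE ->] | _] /=.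
  by rewrite !mulr1 mul1r addr0.
case: ((i \in K) != (i \in T)) => /=; last by rewrite !mulr1 letterD.
by case: (i + 1 \in K); rewrite /= ?mulr1 ?mul1r ?addr0 ?add0r.
Qed.

End Cylinder.

(** Sorted by the carry set before the flip, the pivotal [c] form the cylinders just weighed. The
    exceptional fibre over [setT] does not occur, because [v + 1] carries nothing. *)
Lemma sum_pivotal n v : (n <= #|~: T|)%N ->
  \sum_(c : {set I} | (v \notin c) && (hits T (carry T c) < n <= hits T (carry T (v |: c)))%N)
    weight_off v c =
  (1 - 'X) ^+ n.-1 * \sum_(K : {set I} | flippable n v K) 'X^((misses T K).-1).
Proof.
move=> le_n; rewrite (partition_big (carry T) predT) //= mulr_sumr [RHS]big_mkcond.
apply: eq_bigr => K _; case: ifPn => flipK.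
  rewrite -(weight_off_cylinder le_n flipK); apply: eq_bigl => c.
  have nK : K != setT.
    by apply: contraNneq (flippable_succ le_n flipK) => ->; rewrite inE.
  rewrite -carry_eq //; have [vc | //] := boolP (v \notin c).
  have [eK | _] := eqVneq (carry T c) K; last by rewrite andbF.
  have/and4P[adK lt_n vD dis] := flipK.
  by rewrite andbT /= eK lt_n flip_hits // eK ?lt_n ?le_n // vD dis.
apply: big_pred0 => c; apply/negbTE; apply: contra flipK.
case/andP=> /and3P[vc lt_n le_hits] /eqP eK.
move: le_hits; rewrite flip_hits ?lt_n ?le_n // eK => /and3P[vD dis _].
rewrite eK in lt_n.
rewrite /flippable lt_n vD dis /= andbT.
by have := carry_sol_carry T c; rewrite carry_sol_cylinder eK => /andP[].
Qed.

(* Russo's formula for the event [n <= hits].                                  *)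
Lemma deriv_weight_tail n : (0 < n <= #|~: T|)%N ->
  ((1 - 'X) ^+ n * tail_poly T n)^`() = - ((1 - 'X) ^+ n.-1 * flip_poly n).
Proof.
case/andP=> n_gt0 le_n; rewrite -weight_tail raddf_sum /=.
under eq_bigr do rewrite /weight deriv_prod.
rewrite exchange_big /flip_poly mulr_sumr -sumrN /=; apply: eq_bigr => v _.
rewrite -sum_pivotal //.
have dl c : (letter (v \in c))^`() * (\prod_(i | i != v) letter (i \in c)) =
    (if v \in c then -1 else 1) * weight_off v c.
  rewrite /letter; case: (v \in c); last by rewrite derivX.
  by rewrite derivB derivX derivC sub0r.
under eq_bigr do rewrite dl.
rewrite (bigID (fun c => v \in c)) /=.
(* Sets containing [v] are paired with those without it. Since carries are monotone in [c], all
   pairs cancel except the pivotal ones. *)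
rewrite (reindex_onto (fun c => v |: c) (fun c => c :\ v)) /=; last first.
  by move=> c /andP[_ vc]; rewrite setD1K.
have offU c : weight_off v (v |: c) = weight_off v c.
  by apply: eq_bigr => i niv; rewrite !inE (negbTE niv).
rewrite (eq_bigl (fun c => (v \notin c) && (n <= hits T (carry T (v |: c)))%N)); last first.
  move=> c; rewrite setU11 andbT andbC; congr (_ && _).
  apply/eqP/idP => [<- | vc]; first by rewrite !inE eqxx.
  by rewrite setU1K.
rewrite (eq_bigr (fun c => - weight_off v c)) => [|c _]; last first.
  by rewrite setU11 mulN1r offU.
rewrite [X in _ + X](eq_bigr (fun c => weight_off v c)) => [|c /andP[_ /negbTE ->]]; last first.
  by rewrite mul1r.
rewrite sumrN addrC -opprB; congr (- _); apply/eqP; rewrite subr_eq; apply/eqP.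
rewrite [LHS](bigID (fun c => (n <= hits T (carry T c))%N)) /= addrC; congr (_ + _).
  apply: eq_bigl => c; rewrite -ltnNge.
  by case: (v \in c); case: (_ < _)%N; case: (_ <= _)%N.
apply: eq_bigl => c; case: (boolP (v \in c)) => vc; rewrite ?andbF ?andbT //=.
case: (boolP (n <= hits T (carry T c))%N) => [le_c | _]; last by rewrite andbF.
by rewrite andbT (leq_trans le_c) // hits_mono // carry_mono // subsetUr.
Qed.

(** Cancelling a power of [1 - X] in Russo's formula leaves [n B - (1 - X) B' = G] for the tail
    polynomial [B] and the flip polynomial [G]; coefficients of degree [s] are compared. *)
Lemma tail_poly_coef n s : (0 < n <= #|~: T|)%N ->
  (n + s)%:R * (tail_poly T n)`_s - s.+1%:R * (tail_poly T n)`_s.+1 = (flip_poly n)`_s.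
Proof.
case: n => [//|n] n_range; have := deriv_weight_tail n_range.
set B := tail_poly T n.+1; set G := flip_poly n.+1 => /= e.
have nz : (1 - 'X : {poly rat}) ^+ n != 0.
  by rewrite expf_neq0 // -oppr_eq0 opprB polyXsubC_eq0.
have {}e : B *+ n.+1 - (1 - 'X) * B^`() = G.
  apply: (mulfI nz); rewrite -[RHS]opprK -e derivM deriv_exp derivB derivX derivC.
  by rewrite sub0r exprS /= -[B *+ _]mulr_natr -[X in X * B]mulr_natr; ring.
rewrite -e mulrBl mul1r opprB coefD coefMn coefB coefXM !coef_deriv.
case: s => [|s] /=; rewrite -!(mulr_natl B`_ _) ?addn0 ?natrD; ring.
Qed.

End Russo.

(** * Truncated evaluation at 1/2 *)

Local Open Scope ring_scope.

(** Value at 1/2 of the part of [q] of degree below [n]. On the summands [X^misses] of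
    [level_poly T n] it keeps exactly those with [misses < n = hits]. *)
Definition trunc_half (n : nat) (q : {poly rat}) := \sum_(0 <= s < n) q`_s * 2^-1 ^+ s.

Lemma trunc_halfD n : {morph trunc_half n : q r / q + r}.
Proof.
by move=> q r; rewrite /trunc_half -big_split; apply: eq_bigr => s _; rewrite coefD mulrDl.
Qed.

Lemma trunc_halfN n : {morph trunc_half n : q / - q}.
Proof. by move=> q; rewrite /trunc_half -sumrN; apply: eq_bigr => s _; rewrite coefN mulNr. Qed.

Lemma trunc_half0 n : trunc_half n 0 = 0.
Proof. by rewrite /trunc_half big1 // => s _; rewrite coef0 mul0r. Qed.

Lemma trunc_half_sum n (J : finType) (P : pred J) (F : J -> {poly rat}) :
  trunc_half n (\sum_(j | P j) F j) = \sum_(j | P j) trunc_half n (F j).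
Proof. exact: (big_morph _ (trunc_halfD n) (trunc_half0 n)). Qed.

Lemma trunc_halfXn n j : trunc_half n 'X^j = (if (j < n)%N then 2^-1 ^+ j else 0).
Proof.
rewrite /trunc_half (eq_bigr (fun s => if s == j then 2^-1 ^+ j else 0)) => [|s _].
  by rewrite -big_mkcond big_nat1_eq.
by rewrite coefXn; case: eqP => [-> | _]; rewrite ?mul1r ?mul0r.
Qed.

Lemma trunc_halfS n q : trunc_half n.+1 q = trunc_half n q + q`_n * 2^-1 ^+ n.
Proof. by rewrite /trunc_half big_nat_recr. Qed.

Lemma trunc_half_mulr1BX m q :
  trunc_half m.+1 ((1 - 'X) * q) =
  2^-1 * trunc_half m.+1 q + 2^-1 ^+ m.+1 * q`_m.
Proof.
elim: m => [|m IHm].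
  by rewrite /trunc_half !big_nat1 mulrBl mul1r coefB coefXM /=; lra.
rewrite /trunc_half in IHm *; rewrite big_nat_recr //= IHm [X in _ = 2^-1 * X + _]big_nat_recr //=.
by rewrite mulrBl mul1r coefB coefXM /= !exprS; set h := 2^-1 ^+ m; field.
Qed.

(** By [trunc_half_mulr1BX], the factor [1 - X] halves a truncated value up to a boundary term. The
    halved value cancels against the next summand, and of [B n] only the coefficients of index
    [n - 1] and [n - 2] survive. *)
Lemma trunc_half_telescope (B : nat -> {poly rat}) m :
  \sum_(1 <= n < m.+2) 2^-1 ^+ n * trunc_half n (B n - (1 - 'X) * B n.+1) =
  2^-1 * (B 1%N)`_0
  + \sum_(2 <= n < m.+2) 2^-1 ^+ (2 * n).-1 * ((B n)`_n.-1 - 2 * (B n)`_n.-2)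
  - 2^-1 ^+ m.+1 * trunc_half m.+1 ((1 - 'X) * B m.+2).
Proof.
elim: m => [|m IHm].
  rewrite big_nat1 big_geq // addr0 trunc_halfD trunc_halfN.
  by rewrite {1}/trunc_half big_nat1 expr0 expr1; ring.
rewrite big_nat_recr // IHm [in RHS]big_nat_recr // trunc_halfD trunc_halfN.
rewrite trunc_half_mulr1BX (trunc_halfS m.+1 (B m.+2)).
have -> : (2 * m.+2).-1 = (m.+1 + m.+2)%N by lia.
rewrite exprD ![2^-1 ^+ m.+2]exprS -!pred_Sn /=.
by set x := trunc_half m.+1 (B m.+2); set h := 2^-1 ^+ m.+1; field.
Qed.

(** * Exact formula for the number of heavy sets *)

Section Count.

Variable p : nat.
Local Notation I := 'I_p.+2.
Variable T : {set I}.
Hypotheses (T_neq0 : T != set0) (T_neqT : T != setT).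
Implicit Types (c K A : {set I}) (i v : I).

Let Z := #|~: T|.
Let w := #|T|.

Lemma card_zeros_ones : (#|~: T| + #|T|)%N = p.+2.
Proof. by rewrite addnC cardsC card_ord. Qed.

Lemma zeros_gt0 : (0 < #|~: T|)%N.
Proof. by rewrite card_gt0 -subset0 subCset setC0 subTset. Qed.

Lemma weight_half c : (weight c).[2^-1] = 2^-1 ^+ p.+2.
Proof.
rewrite /weight horner_prod (eq_bigr (fun=> 2^-1)) ?prodr_const ?card_ord // => i _.
by rewrite /letter; case: (i \in c); rewrite !hornerE //; field.
Qed.

Lemma card_weight (P : pred {set I}) :
  #|[set c | P c]|%:R * 2^-1 ^+ p.+2 = (\sum_(c : {set I} | P c) weight c).[2^-1].
Proof.
rewrite horner_sum (eq_bigr (fun=> 2^-1 ^+ p.+2)) => [|c _]; last exact: weight_half.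
by rewrite sumr_const cardsE mulr_natl.
Qed.

Definition heavy := [set c | (#|T| < #|carry T c|)%N].

Lemma card_lt_hits K : (#|T| < #|K|)%N = (misses T K < hits T K)%N.
Proof. by rewrite -(cardsID T K) -(cardsID K T) [K :&: T]setIC ltn_add2l. Qed.

Lemma trunc_half_level n : 
  2^-1 ^+ n * trunc_half n (level_poly T n) =
  \sum_(K : {set I} | [&& admissible T K, K != setT & hits T K == n])
     (if (misses T K < hits T K)%N then 2^-1 ^+ (hits T K + misses T K) else 0)
  + (if n == Z then 2^-1 ^+ Z * (1 - (w < Z)%N%:R * 2^-1 ^+ w) else 0).
Proof.
rewrite /level_poly trunc_halfD mulrDr trunc_half_sum mulr_sumr; congr (_ + _).
  apply: eq_bigr => K /and3P[_ _ /eqP <-]; rewrite trunc_halfXn.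
  by case: ifP => _; rewrite ?mulr0 // exprD.
rewrite -/Z -/w; case: eqP => [-> | _]; last by rewrite trunc_half0 mulr0.
rewrite -(expr0 'X) trunc_halfD trunc_halfN !trunc_halfXn zeros_gt0 expr0.
by case: ifP => _; rewrite ?mul1r ?mul0r.
Qed.

(** For [K != setT] truncation selects precisely the heavy sets. The fibre of [setT] is always heavy
    and has measure [2^-Z (1 - 2^-w)], but truncation at degree [Z] drops its [X^w] when [Z <= w];
    the last term corrects this. *)
Lemma heavy_sum :
  #|heavy|%:R * 2^-1 ^+ p.+2 =
  \sum_(1 <= n < Z.+1) 2^-1 ^+ n * trunc_half n (level_poly T n)
  - (Z <= w)%N%:R * 2^-1 ^+ p.+2.
Proof.
under eq_bigr do rewrite trunc_half_level.
rewrite big_split /=.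
have -> : \sum_(1 <= n < Z.+1)
    (if n == Z then 2^-1 ^+ Z * (1 - (w < Z)%N%:R * 2^-1 ^+ w) else 0) =
    2^-1 ^+ Z * (1 - (w < Z)%N%:R * 2^-1 ^+ w) :> rat.
  by rewrite -big_mkcond big_nat1_eq ltnSn zeros_gt0.
under eq_bigr do rewrite big_mkcond.
rewrite exchange_big /= card_weight (partition_big (carry T) predT) //=.
rewrite horner_sum (bigD1 setT) //= [X in _ = X + _ - _](bigD1 setT) //=.
rewrite [X in _ = X + _ + _ - _]big1 ?add0r; last by move=> n _; rewrite eqxx andbF.
rewrite addrC -addrA; congr (_ + _).
  apply: eq_bigr => K nK; rewrite nK /=.
  rewrite (eq_bigl (fun c => (misses T K < hits T K)%N && (carry T c == K))); last first.
    by move=> c; rewrite -card_lt_hits; case: (carry T c =P K) => [-> | _]; rewrite ?andbF.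
  have [lt_K | _] /= := ltnP (misses T K) (hits T K); last first.
    by rewrite big_pred0_eq horner0 big1 // => n _; case: ifP.
  rewrite sum_carry_eq //; have [adK | nad] := boolP (admissible T K); last first.
    by rewrite sum_sol_inadmissible // horner0 big1.
  rewrite weight_sol // !hornerE /= -big_mkcond.
  rewrite (eq_bigl (fun n => n == hits T K)) => [|n]; last exact: eq_sym.
  rewrite big_nat1_eq ltnS hits_le andbT (leq_ltn_trans _ lt_K) // exprD.
  by congr (_ ^+ _ * _); field.
rewrite (eq_bigl (fun c => carry T c == setT)); last first.
  move=> c; case: (carry T c =P setT) => [-> | _]; rewrite ?andbF ?andbT //.
  by rewrite card_lt_hits hitsT missesT zeros_gt0.
have -> : 2^-1 ^+ p.+2 = 2^-1 ^+ Z * 2^-1 ^+ w :> rat.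
  by rewrite -exprD card_zeros_ones.
rewrite weight_carryT -/Z -/w !hornerE /=.
have -> : 1 - 2^-1 = 2^-1 :> rat by field.
by rewrite ltnNge; case: (Z <= w)%N => /=; ring.
Qed.

Lemma tail_poly_rec n : (n <= Z)%N ->
  level_poly T n = tail_poly T n - (1 - 'X) * tail_poly T n.+1.
Proof.
move=> le_n; rewrite /tail_poly big_nat_recl // subnn expr0 mul1r.
rewrite mulr_sumr (_ : \sum_(n <= i < _) _ =
    \sum_(n.+1 <= m < Z.+1) (1 - 'X) * ((1 - 'X) ^+ (m - n.+1) * level_poly T m)).
  by rewrite addrK.
rewrite big_add1 /= big_nat [RHS]big_nat; apply: eq_bigr => m /andP[le_m _].
by rewrite mulrA -exprS subSS subSn.
Qed.

(** At [X = 0] only [c = setT] has nonzero weight, and as [T] is nonempty its carry set is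
    [setT]. *)
Lemma tail_poly1_coef0 : (tail_poly T 1)`_0 = 1.
Proof.
have := weight_tail T 1; move/(congr1 (fun q : {poly rat} => q.[0])).
rewrite expr1 hornerM [(tail_poly T 1).[0]]horner_coef0 !hornerE ?subr0 ?mul1r => <-.
have eT : carry T setT = setT.
  apply/eqP; rewrite carry_eqT; apply/andP; split.
    by apply/carry_solP => i; rewrite !inE /maj; case: (i \in T).
  by apply: contra T_neq0 => /eqP eT; rewrite -[T]setCK -eT setCT.
rewrite horner_sum (bigD1 setT) /=; last by rewrite eT hitsT zeros_gt0.
rewrite big1 ?addr0 => [|c /andP[_ nc]].
  by rewrite /weight horner_prod big1 // => i _; rewrite inE /letter !hornerE.
have [i ni] : exists i, i \notin c.
  apply/existsP; apply: contraR nc; rewrite negb_exists => /forallP cT.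
  by apply/eqP/setP => i; rewrite inE; apply/negPn.
by rewrite /weight horner_prod (bigD1 i) //= (negbTE ni) /letter hornerX mul0r.
Qed.

Definition flip_count n := (flip_poly T n)`_(n - 2).

(** At [s = n - 2] the factors in [tail_poly_coef] are [2 (n - 1)] and [n - 1]; division by [n - 1]
    gives exactly the combination of coefficients left by the telescoping. *)
Lemma heavy_formula :
  #|heavy|%:R * 2^-1 ^+ p.+2 =
  2^-1 - \sum_(2 <= n < Z.+1) 2^-1 ^+ (2 * n).-1 * (flip_count n / n.-1%:R)
  - (Z <= w)%N%:R * 2^-1 ^+ p.+2.
Proof.
rewrite heavy_sum; congr (_ - _).
rewrite big_nat_cond; under eq_bigr => n /andP[/andP[_ le_n] _].
  rewrite tail_poly_rec //; over.
rewrite -big_nat_cond; have := zeros_gt0; rewrite -/Z; case EZ: Z => [//|m] _.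
rewrite trunc_half_telescope tail_poly1_coef0 mulr1.
have -> : tail_poly T m.+2 = 0 by rewrite /tail_poly -/Z EZ big_geq.
rewrite mulr0 trunc_half0 mulr0 subr0; congr (_ + _).
rewrite -sumrN big_nat [RHS]big_nat; apply: eq_bigr => n /andP[n_gt1 le_n].
rewrite -[RHS]mulrN; congr (_ * _).
have n_range : (0 < n <= #|~: T|)%N by rewrite (ltnW n_gt1) -/Z EZ.
rewrite /flip_count -(tail_poly_coef (n - 2) n_range).
case: n n_gt1 {le_n n_range} => [//|[//|m']] _ /=; rewrite subSS subSS subn0.
have nz : m'.+1%:R != 0 :> rat by rewrite pnatr_eq0.
rewrite (_ : (m'.+2 + m')%:R = 2 * m'.+1%:R :> rat); last by rewrite -natrM; congr (_%:R); lia.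
by move: nz; move: (m'.+1%:R : rat) => x nz; field.
Qed.

Lemma flip_countE n : flip_count n =
  (\sum_v #|[set K | flippable T n v K & (misses T K).-1 == n - 2]|)%N%:R.
Proof.
rewrite /flip_count /flip_poly coef_sum natr_sum; apply: eq_bigr => v _.
rewrite coef_sum -sum1_card natr_sum big_mkcond [RHS]big_mkcond; apply: eq_bigr => K _.
by rewrite inE coefXn eq_sym; case: (flippable _ _ _ _) => //=; case: eqP.
Qed.

End Count.

(** * Pivotal cylinders and gaps *)

Section Gaps.

Variable p : nat.
Local Notation I := 'I_p.+2.
Variable T : {set I}.
Hypotheses (T_neq0 : T != set0) (T_neqT : T != setT).
Implicit Types (c K A : {set I}) (i v : I).

Definition long_gaps := forall v, v \notin T -> window v #|~: T|.-1 \subset T.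

Lemma card_ord_lt m : (m <= p.+2)%N -> #|[set x : I | (x < m)%N]| = m.
Proof.
move=> le_m; rewrite cardsE -sum1_card (big_ord_narrow le_m) sum1_card.
by rewrite card_ord.
Qed.

Lemma card_window v m : (m <= p.+2)%N -> #|window v m| = m.
Proof.
move=> le_m; rewrite -[RHS](card_ord_lt le_m).
rewrite -[RHS](card_preimset _ (f := fun i => i - v - 1)); last by move=> i j /addIr /addIr.
by congr #|pred_of_set _|; apply/setP => i; rewrite !inE.
Qed.

Lemma card_window_to z m : (m <= p.+2)%N -> #|[set i : I | (dist i z < m)%N]| = m.
Proof.
move=> le_m; rewrite -[RHS](card_ord_lt le_m).
rewrite -[RHS](card_preimset _ (f := fun i => z - i - 1)); last by move=> i j /addIr /subrI.
by congr #|pred_of_set _|; apply/setP => i; rewrite !inE.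
Qed.

Lemma dist_from_succ i z : i + 1 != z -> dist i z = (dist (i + 1) z).+1.
Proof.
move=> ni; have := @val_addr1 p (z - (i + 1) - 1).
rewrite (_ : z - (i + 1) - 1 + 1 = z - i - 1) => [|]; last by ring.
by rewrite ifF // -subr_eq0 opprK subrK subr_eq0 eq_sym; exact/negbTE.
Qed.

(** The [Z - 1] positions before [z] hold ones of [T], and none of them receives a carry, for it
    would be passed on through ones up to [z]. One more miss is [z + 1], since no carry leaves
    [z]. *)
Lemma long_gaps_misses K z : long_gaps -> admissible T K -> (1 < #|~: T|)%N ->
  z \notin T -> z \notin K -> (#|~: T| <= misses T K)%N.
Proof.
move=> gapsT /forallP adK Z_gt1 zT zK; set m := #|~: T|.-1.
have Em : #|~: T| = m.+1 by rewrite prednK // (ltn_trans _ Z_gt1).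
have kE := card_zeros_ones T.
have w_gt0 : (0 < #|T|)%N by rewrite card_gt0.
pose A := [set i : I | (dist i z < m)%N].
have AT i : i \in A -> i \in T.
  rewrite inE => lt_i; apply: contraR zT => iT.
  by apply: (subsetP (gapsT _ iT)); rewrite inE.
have AK i : i \in A -> i \notin K.
  have [h] := ubnP (dist i z); elim: h i => // h IHh i lt_h iA.
  apply/negP => iK; have := adK i; rewrite iK (AT i iA) /= => /eqP i1K.
  have [ei | ni] := eqVneq (i + 1) z; first by rewrite ei (negbTE zK) in i1K.
  have di : (dist (i + 1)%R z < dist i z)%N
    by rewrite [ltnRHS]dist_from_succ.
  have A1 : i + 1 \in A by move: iA; rewrite !inE; apply: ltn_trans.
  by move: (IHh _ (leq_trans di lt_h) A1); rewrite i1K.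
have sA : z + 1 |: A \subset T :\: K.
  apply/subsetP => i /setU1P[-> | iA]; last by rewrite inE (AT i iA) (AK i iA).
  rewrite inE; apply/andP; split; last first.
    by apply: (subsetP (gapsT _ zT)); rewrite inE dist_add1 eqxx -ltnS -Em.
  by have := adK z; rewrite (negbTE zT) (negbTE zK) /= => /eqP ->.
apply: leq_trans (subset_leq_card sA).
rewrite cardsU1 card_window_to; last by rewrite /m; lia.
rewrite (_ : z + 1 \notin A) ?Em //.
have n1 : z + 1 != z by rewrite -subr_eq0 addrC addKr oner_eq0.
(* [z + 1] is [p] steps short of [z], and [Z - 1 <= p] because [T] contains a one. *)
by have := dist_self z; rewrite (dist_from_succ n1) inE -leqNgt; move: kE; lia.
Qed.

Lemma hits_lt_exists K : (hits T K < #|~: T|)%N -> exists2 z, z \notin T & z \notin K.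
Proof.
move=> lt_K; have /subsetPn[z] : ~~ (~: T \subset K :\: T).
  by apply/negP => /subset_leq_card; rewrite leqNgt lt_K.
by rewrite !inE => zT; rewrite zT => zK; exists z.
Qed.

Lemma admissible0 : admissible T set0.
Proof. by apply/forallP => i; rewrite !inE; case: (i \in T). Qed.

Lemma misses0 : misses T set0 = #|T|.
Proof. by rewrite /misses setD0. Qed.

Lemma hits0 : hits T set0 = 0%N.
Proof. by rewrite /hits set0D cards0. Qed.

(** This is the bound on misses for [set0], which misses all of [T]. *)
Lemma long_gaps_card : long_gaps -> (#|~: T| <= #|T|)%N.
Proof.
move=> gapsT; have [Z_gt1 | Z_le1] := ltnP 1 #|~: T|; last first.
  by apply: leq_trans Z_le1 _; rewrite card_gt0.
have lt0 : (hits T set0 < #|~: T|)%N by rewrite hits0 (ltn_trans _ Z_gt1).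
have [z zT _] := hits_lt_exists lt0.
have z0 : z \notin (set0 : {set I}) by rewrite inE.
by rewrite -misses0; exact: long_gaps_misses gapsT admissible0 Z_gt1 zT z0.
Qed.

Lemma long_gaps_flip_count n : long_gaps -> (1 < n <= #|~: T|)%N -> flip_count T n = 0.
Proof.
move=> gapsT /andP[n_gt1 le_n]; rewrite flip_countE big1 // => v _.
apply/eqP; rewrite cards_eq0; apply/eqP/setP => K; rewrite !inE.
apply/negP => /andP[/and4P[adK lt_n _ _] /eqP e].
have [z zT zK] := hits_lt_exists (leq_trans lt_n le_n).
by have := long_gaps_misses gapsT adK (leq_trans n_gt1 le_n) zT zK; lia.
Qed.

Lemma flippable0 n v : (0 < n)%N -> flippable T n v set0 = (v \in T).
Proof.
move=> n_gt0; rewrite /flippable admissible0 hits0 n_gt0 !inE /=.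
rewrite (_ : [disjoint set0 & _]) ?andbT; last by rewrite disjoints_subset sub0set.
by case: (v \in T).
Qed.

Definition flip_set n v := [set K | flippable T n v K & ((misses T K).-1 == n - 2)%N].

(** The second hypothesis is the degree condition for [set0], which is flippable at every [v] in
    [T]. *)
Lemma flip_count_ge n : (0 < n)%N -> (#|T|.-1 == n - 2)%N ->
  (#|T| + \sum_(v | v \notin T) #|flip_set n v| <=
   \sum_v #|[set K | flippable T n v K & (misses T K).-1 == n - 2]|)%N.
Proof.
move=> n_gt0 e; rewrite [leqRHS](bigID (fun v => v \in T)) /=.
apply: leq_add => //; rewrite -sum1_card.
apply: leq_sum => v vT; rewrite card_gt0; apply/set0Pn; exists set0.
by rewrite inE flippable0 // misses0 e vT.
Qed.

Section ShortGap.

Variables v x : I.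
Hypotheses (vT : v \notin T) (xT : x \notin T) (lt_x : (dist v x < #|~: T|.-1)%N).
Hypothesis le_w : (#|~: T| <= #|T|.+1)%N.

(** In [K], zeros of [T] carry from distance [f] on and ones from distance [a] on. Here [f] is the
    distance of the first one [y] after [x], and [a] is the least length of a window with [Z - 1]
    ones, so there are [Z - 1] misses. Shortness of the gap gives [f < a]; hence [K] avoids the
    window of length [f], which contains every zero that is not hit. *)
Lemma short_gap_flip : exists K, flippable T #|~: T| v K /\ misses T K = #|~: T|.-1.
Proof.
have kE := card_zeros_ones T.
have ltx := lt_x; have lew := le_w; set Z := #|~: T| in kE ltx lew *.
(* Otherwise [T] would fit into [dist v x < Z - 1 <= #|T|] positions. *)
have [y0 y0T lt_y0] : exists2 y, y \in T & (dist v x < dist v y)%N.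
  have /subsetPn[y yT] : ~~ (T \subset window v (dist v x).+1 :\ x).
    apply/negP => /subset_leq_card; have := cardsD1 x (window v (dist v x).+1).
    rewrite inE ltnSn card_window ?dist_lt // => e le_T.
    have := leq_trans lew (_ : #|T|.+1 <= (dist v x).+1)%N; rewrite e add1n ltnS => /(_ le_T).
    by rewrite -add1n -e; move: ltx; clear; case: (Z) => //= n; rewrite ltnNge => /negP.
  rewrite !inE negb_and negbK ltnS -ltnNge => /orP[/eqP eyx | lt_y]; last by exists y.
  by rewrite eyx (negbTE xT) in yT.
have [y yT [lt_y ymin]] : exists2 y, y \in T & (dist v x < dist v y)%N /\
    forall z, z \in T -> (dist v x < dist v z)%N -> (dist v y <= dist v z)%N.
  pose P y := (y \in T) && (dist v x < dist v y)%N.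
  have P0 : P y0 by rewrite /P y0T.
  case: (arg_minnP (dist v) P0) => y /andP[yT lt_y] ymin; exists y => //; split=> // z zT lt_z.
  by apply: ymin; rewrite /P zT.
set f := dist v y in lt_y ymin.
have lt_f : (f < p.+1)%N.
  have := dist_lt v y; rewrite ltnS leq_eqVlt -/f => /orP[/eqP ef | //].
  have eyv : y = v by apply: (@dist_inj p v); rewrite dist_self.
  by move: vT; rewrite -eyv yT.
(* The ones nearer than [y] are nearer than [x], so there are at most [dist v x] of them. *)
have countf : (zeros_in (~: T) v f < Z.-1)%N.
  apply: leq_ltn_trans ltx; rewrite -[leqRHS](@card_window v) ?(ltnW (dist_lt v x)) //.
  apply: subset_leq_card; apply/subsetP => i; rewrite !inE negbK => /andP[iT lt_i].
  rewrite ltnNge leq_eqVlt negb_or; apply/andP; split.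
    by apply: contraNneq xT => /dist_inj ->.
  by apply/negP => /(ymin i iT); rewrite leqNgt lt_i.
have Z1_gt0 : (0 < Z.-1)%N by apply: leq_ltn_trans ltx.
have le_Z1 : (Z.-1 <= #|~: ~: T|)%N by rewrite setCK; move: lew; lia.
(* Zeros of [~: T] are ones of [T], so [reach] counts ones here. *)
set a := reach (~: T) v Z.-1.
have lt_fa : (f < a)%N.
  rewrite ltnNge; apply/negP => /(zeros_in_mono (~: T) v).
  by rewrite leqNgt (leq_trans countf) // reachP.
have counta : zeros_in (~: T) v a = Z.-1.
  have a_gt0 : (0 < a)%N by apply: leq_ltn_trans lt_fa.
  apply/eqP; rewrite eqn_leq reachP // andbT.
  have := zeros_inS (~: T) v a.-1; rewrite prednK // zeros_before_reach //.
  by rewrite prednK.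
pose K := [set i : I | (if i \in T then a else f) <= dist v i]%N.
have vK : v \in K by rewrite inE (negbTE vT) dist_self ltnW.
have adK : admissible T K.
  apply/forallP => i; apply/implyP; rewrite !inE.
  have [iT | iT] := boolP (i \in T).
    have niv : i != v by apply: contraNneq vT => <-.
    move=> /eqP le_i; rewrite dist_add1 (negbTE niv).
    by case: ifP => _; move: le_i lt_fa; lia.
  rewrite eqbF_neg -ltnNge => lt_i.
  have niv : i != v by apply: contraTneq lt_i => ->; rewrite dist_self; lia.
  rewrite dist_add1 (negbTE niv) eqbF_neg -ltnNge.
  case: ifP => [_ | i1T]; first by move: lt_i lt_fa; lia.
  (* Only a zero at distance exactly [f] could violate admissibility, but that position is [y], a
     one. *)
  rewrite ltn_neqAle lt_i andbT; apply: contraFneq i1T => e.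
  suff -> : i + 1 = y by [].
  by apply: (@dist_inj p v); rewrite dist_add1 (negbTE niv) e.
have missesK : misses T K = Z.-1.
  rewrite -counta; apply: eq_card => i; rewrite !inE negbK -ltnNge.
  by case: (i \in T); rewrite ?andbF ?andbT.
have hitsK : (hits T K + zeros_in T v f)%N = Z.
  rewrite /Z -(cardsID (window v f) (~: T)) addnC; congr (_ + _)%N.
    by apply: eq_card => i; rewrite !inE andbC.
  by apply: eq_card => i; rewrite !inE -leqNgt; case: (i \in T); rewrite ?andbF ?andbT.
have f_zero : (0 < zeros_in T v f)%N.
  by rewrite card_gt0; apply/set0Pn; exists x; rewrite !inE xT.
exists K; split=> //; rewrite /flippable adK inE vK (negbTE vT) /=.
rewrite -[X in (_ < X)%N]hitsK -addn1 leq_add2l f_zero /=.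
rewrite -hitsK addKn; set e := reach T v _.
have le_ef : (e <= f)%N.
  rewrite leqNgt; apply/negP => /reach_min; rewrite ltnn => H; apply: notF; apply: H.
  by rewrite -/Z -hitsK leq_addl.
rewrite disjoint_sym disjoints_subset; apply/subsetP => i.
rewrite !inE -ltnNge => lt_i; have := leq_trans lt_i le_ef.
by case: ifP => _ // /leq_trans; apply; apply: ltnW.
Qed.

End ShortGap.

Definition deficit n : rat := 2^-1 ^+ (2 * n).-1 * (flip_count T n / n.-1%:R).

Lemma deficit_ge0 n : 0 <= deficit n.
Proof. by rewrite mulr_ge0 ?exprn_ge0 ?invr_ge0 // divr_ge0 ?ler0n // flip_countE ler0n. Qed.

Lemma deficit_le_sum n : (1 < n <= #|~: T|)%N ->
  deficit n <= \sum_(2 <= m < #|~: T|.+1) deficit m.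
Proof.
move=> n_range; rewrite (bigD1_seq n) ?iota_uniq ?mem_index_iota //=.
by rewrite lerDl sumr_ge0 // => m _; apply: deficit_ge0.
Qed.

Lemma heavy_eq : #|heavy T| = (2 ^ p.+1 - 1)%N <->
  \sum_(2 <= n < #|~: T|.+1) deficit n = (#|T| < #|~: T|)%N%:R * 2^-1 ^+ p.+2.
Proof.
have := heavy_formula T_neq0 T_neqT; rewrite -/(deficit _).
set s := \sum_(2 <= n < _) deficit n; set h := 2^-1 ^+ p.+2 => eH.
have h2 : (2 ^ p.+1)%N%:R * h = 2^-1.
  rewrite /h exprS mulrCA natrX -exprMn divff // expr1n mulr1.
  by [].
have h_neq0 : h != 0 by rewrite expf_neq0.
have -> : (#|heavy T| = 2 ^ p.+1 - 1)%N <-> (#|heavy T|.+1 = 2 ^ p.+1)%N.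
  by have := expn_gt0 2 p.+1; lia.
have -> : (#|heavy T|.+1 = 2 ^ p.+1)%N <-> #|heavy T|.+1%:R * h = 2^-1.
  split=> [-> // | e]; apply/eqP; rewrite -(eqr_nat rat); apply/eqP.
  by apply: (mulIf h_neq0); rewrite e h2.
rewrite -addn1 natrD mulrDl mul1r eH ltnNge.
by case: (_ <= _)%N => /=; split; lra.
Qed.

Lemma heavy_long_gaps : #|heavy T| = (2 ^ p.+1 - 1)%N <-> long_gaps.
Proof.
have kE := card_zeros_ones T; have w_gt0 : (0 < #|T|)%N by rewrite card_gt0.
split=> [/heavy_eq es v vT | gapsT]; last first.
  apply/heavy_eq; rewrite ltnNge long_gaps_card // mul0r big_nat big1 // => n /andP[n_gt1 le_n].
  by rewrite /deficit long_gaps_flip_count ?n_gt1 // mul0r mulr0.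
apply/subsetP => x; rewrite inE => lt_x; apply/negPn/negP => xT.
suff : (#|T| < #|~: T|)%N%:R * 2^-1 ^+ p.+2 < \sum_(2 <= n < #|~: T|.+1) deficit n.
  by rewrite es ltxx.
have h_gt0 : 0 < 2^-1 ^+ p.+2 :> rat by rewrite exprn_gt0.
have Z_gt1 : (1 < #|~: T|)%N by lia.
have [lt_wZ | le_Zw] := ltnP #|T|.+1 #|~: T|.
  (* With few ones, [set0] alone makes the deficit at [n = #|T| + 1] at least [2^-(2 #|T| + 1)],
     which exceeds [2^-k] as [k = #|T| + Z]. *)
  rewrite (ltnW lt_wZ) mul1r.
  apply: lt_le_trans (@deficit_le_sum #|T|.+1 _); last by rewrite ltnS w_gt0 ltnW.
  have w_neq0 : #|T|%:R != 0 :> rat by rewrite pnatr_eq0 -lt0n.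
  apply: (@lt_le_trans _ _ (2^-1 ^+ (2 * #|T|.+1).-1)).
    by rewrite ltr_iXn2l ?invf_lt1 ?ltr1n //; move: kE lt_wZ; clear; lia.
  rewrite /deficit ler_peMr ?exprn_ge0 ?invr_ge0 //= ler_pdivlMr ?ltr0n // mul1r.
  rewrite flip_countE ler_nat; apply: leq_trans (flip_count_ge _ _) => //.
    exact: leq_addr.
  by rewrite subSS subn1.
have [K [flipK missesK]] := short_gap_flip vT xT lt_x le_Zw.
have flipZ : (0 < #|flip_set #|~: T| v|)%N.
  rewrite card_gt0; apply/set0Pn; exists K; rewrite inE flipK missesK /=.
  by apply/eqP; lia.
apply: lt_le_trans (@deficit_le_sum #|~: T| _); last by rewrite Z_gt1 leqnn.
have [lt_wZ | _] := ltnP #|T| #|~: T|; last first.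
  rewrite mul0r /deficit mulr_gt0 ?exprn_gt0 // divr_gt0 ?ltr0n //; last by lia.
  by rewrite flip_countE ltr0n (bigD1 v) //= addn_gt0 flipZ.
(* In this borderline case [2 Z - 1 = k], so the deficit at [Z] is [2^-k] times the flip count
   divided by [#|T|]. The set [set0] contributes [#|T|] flips, and the short gap one more, at [v]
   outside [T]. *)
have EZ : #|~: T| = #|T|.+1 by lia.
rewrite mul1r /deficit (_ : (2 * #|~: T|).-1 = p.+2); last by lia.
rewrite ltr_pMr // EZ /= ltr_pdivlMr ?ltr0n // mul1r -EZ flip_countE ltr_nat.
apply: leq_trans (@flip_count_ge #|~: T| _ _); [ | by lia | by apply/eqP; lia].
by rewrite -addn1 leq_add2l (bigD1 v) //= addn_gt0 flipZ.
Qed.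

End Gaps.

Local Close Scope ring_scope.

(** * Words of integers *)

Section Binary.

Implicit Types (n m i x : nat) (b : nat -> bool).

Definition binval b n := \sum_(i < n) b i * 2 ^ i.

Lemma binval_lt b n : binval b n < 2 ^ n.
Proof.
rewrite /binval; elim: n => [|n IHn]; first by rewrite big_ord0.
rewrite big_ord_recr /= expnS mul2n -addnn.
by case: (b n); rewrite ?mul1n ?mul0n ?addn0 ?ltn_add2r // ltn_addr.
Qed.

Lemma bit_binval b n i : i < n -> bit (binval b n) i = b i.
Proof.
elim: n => // n IHn; rewrite ltnS leq_eqVlt /binval big_ord_recr /= => /orP[/eqP -> | lt_in].
  rewrite /bit addnC divnMDl ?expn_gt0 //.
  by rewrite divn_small ?binval_lt // addn0; case: (b n).
have En : 2 ^ n = 2 ^ (n - i.+1).+1 * 2 ^ i by rewrite -expnD; congr (2 ^ _); lia.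
rewrite -[in RHS]IHn // /bit En mulnA addnC divnMDl ?expn_gt0 // oddD.
by rewrite oddM expnS oddM andbF.
Qed.

Lemma bitS x i : bit x i.+1 = bit (x %/ 2) i.
Proof. by rewrite /bit expnS divnMA. Qed.

Lemma binval_bit x n : x < 2 ^ n -> binval (bit x) n = x.
Proof.
rewrite /binval; elim: n x => [|n IHn] x; first by rewrite big_ord0 ltnS leqn0 => /eqP.
rewrite expnS => lt_x; rewrite big_ord_recl muln1 /bit divn1.
have e : x %/ 2 < 2 ^ n by rewrite ltn_divLR // mulnC.
rewrite -[RHS]odd_double_half -mul2n -divn2 -[in RHS](IHn _ e) big_distrr /=; congr (_ + _).
apply: eq_bigr => i _; rewrite /bump /= add1n -/(bit _ _) -/(bit _ _) bitS expnS.
by rewrite mulnCA.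
Qed.

Lemma bit_small x n : x < 2 ^ n -> bit x n = false.
Proof. by move=> lt_x; rewrite /bit divn_small. Qed.

Lemma sum_bit_widen x n m : x < 2 ^ n -> \sum_(i < n + m) bit x i = \sum_(i < n) bit x i :> nat.
Proof.
move=> lt_x; elim: m => [|m IHm]; first by rewrite addn0.
rewrite addnS big_ord_recr /= IHm bit_small ?addn0 //.
by apply: leq_trans lt_x _; rewrite leq_exp2l // leq_addr.
Qed.

Lemma wtE x n : x < 2 ^ n -> wt x = \sum_(i < n) bit x i.
Proof.
move=> lt_x; rewrite -(sum_bit_widen x lt_x) addnC sum_bit_widen //.
exact: ltn_expl.
Qed.

End Binary.

(** * From pairs of residues to carry sets, and from words to windows *)

Section Link.

Variable p : nat.
Local Notation k := p.+2.
Local Notation I := 'I_p.+2.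
Implicit Types (A c K : {set I}).

Definition setval A : nat := \sum_(i in A) 2 ^ i.

Definition bits (x : nat) : {set I} := [set i : I | bit x i].

Lemma setvalE A : setval A = binval (fun i => inord i \in A) k.
Proof.
rewrite /setval /binval big_mkcond; apply: eq_bigr => i _; rewrite inord_val.
by case: (i \in A); rewrite ?mul1n ?mul0n.
Qed.

Lemma bits_setval A : bits (setval A) = A.
Proof. by apply/setP=> i; rewrite inE setvalE bit_binval // inord_val. Qed.

Lemma setval_lt A : setval A < 2 ^ k.
Proof. by rewrite setvalE binval_lt. Qed.

Lemma setval_bits x : x < 2 ^ k -> setval (bits x) = x.
Proof.
move=> lt_x; rewrite setvalE -[RHS](binval_bit lt_x).
by apply: eq_bigr => i _; rewrite inE inord_val.
Qed.

Lemma setvalT : setval setT = 2 ^ k - 1.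
Proof.
rewrite subn1 predn_exp mul1n /setval; apply: eq_bigl => i; exact: in_setT.
Qed.

Lemma setvalC A : setval A + setval (~: A) = 2 ^ k - 1.
Proof.
rewrite -setvalT /setval [RHS](bigID (mem A)) /=.
by congr (_ + _); apply: eq_bigl => i; rewrite !inE.
Qed.

Lemma setval_lt_pred A : A != setT -> setval A < 2 ^ k - 1.
Proof.
move=> nA; rewrite ltn_neqAle -(setvalC A) leq_addr andbT -[X in X != _]addn0 eqn_add2l.
apply: contra nA => /eqP e; rewrite -(bits_setval A) -[setval A]addn0 e setvalC.
by rewrite -setvalT bits_setval.
Qed.

Lemma wt_setval A : wt (setval A) = #|A|.
Proof.
rewrite (wtE (setval_lt A)) -sum1_card [RHS]big_mkcond; apply: eq_bigr => i _.
have := bits_setval A => /setP/(_ i); rewrite inE => ->.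
by case: (i \in A).
Qed.

Section Addition.

Variables (T c K : {set I}).
Hypothesis solK : carry_sol T c K.

Definition sum_bits : {set I} := [set i : I | (i \in T) (+) (i \in c) (+) (i \in K)].

Let full_adder i : (i \in sum_bits) + 2 * (i + 1 \in K)%R = (i \in T) + (i \in c) + (i \in K).
Proof.
by rewrite inE (carry_solP _ _ _ solK) /maj; case: (i \in T); case: (i \in c); case: (i \in K).
Qed.

Let setval_sum A : setval A = \sum_i (i \in A) * 2 ^ i.
Proof.
rewrite /setval big_mkcond; apply: eq_bigr => i _.
by case: (i \in A); rewrite ?mul1n ?mul0n.
Qed.

Let card_sum A : #|A| = \sum_i (i \in A).
Proof. by rewrite -sum1_card big_mkcond. Qed.

Let sum_shift (F : I -> nat) : \sum_i F (i + 1)%R = \sum_i F i.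
Proof. by rewrite [RHS](reindex_inj (@addIr _ 1%R)). Qed.

Lemma card_sum_bits : #|sum_bits| + #|K| = #|T| + #|c|.
Proof.
apply/eqP; rewrite -(eqn_add2r #|K|); apply/eqP.
rewrite -addnA addnn -mul2n !card_sum -{1}(sum_shift (fun i => (i \in K) : nat)).
rewrite big_distrr /= -!big_split. by apply: eq_bigr => i _; apply: full_adder.
Qed.

(** A carry out of the top position has value [2 ^ k] but re-enters at position 0 with value 1, a
    loss of [2 ^ k - 1]. *)
Lemma setval_sum_bits :
  setval sum_bits + (0%R \in K) * (2 ^ k - 1) = setval T + setval c.
Proof.
have succ (i : I) : 2 * 2 ^ i = 2 ^ (i + 1)%R + (i == -1)%R * (2 ^ k - 1).
  rewrite val_addr1; case: eqP => [ei | _] /=; last by rewrite addn0 expnS.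
  have -> : i = p.+1 :> nat by rewrite ei; have := dist_self (0%R : I); rewrite /dist subrr sub0r.
  by rewrite -expnS mul1n expn0 subnKC // expn_gt0.
apply/eqP; rewrite -(eqn_add2r (setval K)) !setval_sum; apply/eqP.
rewrite -!big_split /=.
rewrite [RHS](eq_bigr (fun i => (i \in sum_bits) * 2 ^ i + (i + 1 \in K)%R * (2 ^ (i + 1)%R)
    + (i == -1)%R * ((i + 1 \in K)%R * (2 ^ k - 1)))); last first.
  move=> i _; have := full_adder i; have := succ i.
  move: (2 ^ i) (2 ^ (i + 1)%R) (2 ^ k - 1) => x y N.
  by case: (i == -1)%R; case: (i \in sum_bits); case: (i + 1 \in K)%R; case: (i \in T);
    case: (i \in c); case: (i \in K) => //=; lia.
rewrite !big_split /= (sum_shift (fun i => (i \in K) * 2 ^ i)).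
have -> : \sum_(i : I) (i == -1)%R * ((i + 1 \in K)%R * (2 ^ k - 1)) = (0%R \in K) * (2 ^ k - 1).
  rewrite (bigD1 (-1)%R) //= eqxx mul1n addNr big1 ?addn0 // => i /negbTE ->.
  by rewrite mul0n.
by rewrite addnAC.
Qed.

(** With an end-around carry, an all-ones sum would require [t + c = 2 (2^k - 1)], which is too
    large; without one, it makes [c] the complement of [T]. *)
Lemma sum_bitsT : setval T < 2 ^ k - 1 -> c != ~: T -> sum_bits != setT.
Proof.
move=> ltT; apply: contraNneq => eT; have := setval_sum_bits; rewrite eT setvalT.
have le_c : setval c <= 2 ^ k - 1 by rewrite -(setvalC c) leq_addr.
case: (0%R \in K); rewrite ?mul1n ?mul0n ?addn0; first by move: le_c ltT; lia.
rewrite -(setvalC T) => /addnI e.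
by rewrite -[c]bits_setval -e bits_setval.
Qed.

End Addition.

Variable t : nat.
Hypotheses (t_gt0 : 0 < t) (t_lt : t < 2 ^ k - 1).

Let T := bits t.

Let setvalTt : setval T = t.
Proof. by apply: setval_bits; apply: leq_trans t_lt (leq_subr _ _). Qed.

Lemma bits_neq0 : T != set0.
Proof.
by apply: contraTneq t_gt0 => eT; rewrite -setvalTt eT /setval big_set0.
Qed.

Lemma bits_neqT : T != setT.
Proof. by apply: contraTneq t_lt => eT; rewrite -setvalTt eT setvalT ltnn. Qed.

Lemma heavy_neq0 c : c \in heavy T -> c != set0.
Proof.
rewrite inE; apply: contraTneq => ->; rewrite -leqNgt.
suff -> : carry T set0 = set0 by rewrite cards0.
apply/eqP; rewrite -subset0; apply: carry_least; apply/subsetP => i.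
by rewrite !inE /maj.
Qed.

Lemma compl_notin_heavy : ~: T \notin heavy T.
Proof. by rewrite inE carry_compl cards0. Qed.

Let pred_lt : 2 ^ k - 1 < 2 ^ k.
Proof. by rewrite subn1 prednK // expn_gt0. Qed.

Let ord_lt (a : 'I_(2 ^ k - 1)) : a < 2 ^ k.
Proof. exact: ltn_trans (ltn_ord a) pred_lt. Qed.

(* The word of [2 ^ k - 1 - a], for a pair [(a, b)]. *)
Definition addend (ab : 'I_(2 ^ k - 1) * 'I_(2 ^ k - 1)) : {set I} := ~: bits ab.1.

Lemma addend_inj : {in Stk t k &, injective addend}.
Proof.
move=> [a b] [a' b']; rewrite !inE /= => /andP[/eqP e _] /andP[/eqP e' _] /setC_inj ea.
have eaa : a = a'.
  by apply: val_inj; move/(congr1 setval): ea => /=; rewrite !setval_bits.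
congr (_, _) => //; apply: val_inj => /=.
have := e; rewrite -e' -eaa => /eqP; rewrite eqn_modDl !modn_small // => /eqP //.
Qed.

Lemma Stk_pair c K a b : carry_sol T c K -> a = setval (~: c) -> b = setval (sum_bits T c K) ->
  a + b = t %[mod 2 ^ k - 1] /\ (wt a + wt b < k) = (#|T| < #|K|).
Proof.
move=> solK -> ->; have eS := setval_sum_bits solK; have eC := card_sum_bits solK.
have e := setvalC c; split.
  rewrite -[in RHS](modnMDl (~~ (0%R \in K)) t); move: eS; rewrite setvalTt.
  case: (0%R \in K); rewrite ?mul1n ?mul0n ?addn0 => eS /=; last by congr (_ %% _); move: e eS; lia.
  by congr (_ %% _); move: e eS; lia.
rewrite !wt_setval; have := cardsC c; rewrite card_ord => ec.
by move: eC ec; lia.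
Qed.

(** For [c = ~: T] the carry-free sum is all ones, while the residue is represented by 0; this set
    is not heavy and comes from the pair [(t, 0)]. The set [set0], for which [a] would be
    [2 ^ k - 1], is not heavy either. *)
Lemma Stk_addend : addend @: Stk t k = ~: T |: heavy T.
Proof.
apply/setP => c; apply/imsetP/setU1P => [[[a b] /= abS ->] | ]; last first.
  have N_gt0 : 0 < 2 ^ k - 1 by apply: ltn_trans t_lt.
  case=> [-> | cH].
    exists (Ordinal t_lt, Ordinal N_gt0) => //; rewrite inE /= addn0 eqxx /=.
    rewrite -{1}setvalTt wt_setval (_ : wt 0 = 0) ?addn0; last by rewrite /wt big_ord0.
    rewrite -[X in _ < X](card_ord k) -cardsT; apply: proper_card.
    by rewrite properT bits_neqT.
  have nc : c != ~: T by apply: contraTneq cH => ->; apply: compl_notin_heavy.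
  have lt_a : setval (~: c) < 2 ^ k - 1.
    by apply: setval_lt_pred; rewrite -setC0 (inj_eq (@setC_inj _)) heavy_neq0.
  have lt_b : setval (sum_bits T c (carry T c)) < 2 ^ k - 1.
    by apply: setval_lt_pred; apply: sum_bitsT (carry_sol_carry T c) _ nc; rewrite setvalTt.
  exists (Ordinal lt_a, Ordinal lt_b); last by rewrite /addend /= bits_setval setCK.
  have [e ew] := Stk_pair (carry_sol_carry T c) (erefl _) (erefl _).
  by rewrite inE /= e eqxx ew; move: cH; rewrite inE.
set c' := addend (a, b); have [-> | nc] := eqVneq c' (~: T); [by left | right].
move: abS; rewrite !inE /= => /andP[/eqP eab lt_ab].
have ea : val a = setval (~: c') by rewrite /c' /addend /= setCK setval_bits.
have [e ew] := Stk_pair (carry_sol_carry T c') ea (erefl _).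
rewrite -ew (_ : setval _ = b) //.
have := e; rewrite -eab => /eqP; rewrite eqn_modDl !modn_small // => [/eqP // |].
by apply: setval_lt_pred; apply: sum_bitsT (carry_sol_carry T c') _ nc; rewrite setvalTt.
Qed.

Lemma card_Stk : #|Stk t k| = #|heavy T|.+1.
Proof.
rewrite -(card_in_imset addend_inj) Stk_addend cardsU1.
by rewrite compl_notin_heavy.
Qed.

Lemma size_zeros : size (zeros (word k t)) = #|~: T|.
Proof.
rewrite /zeros size_filter /word size_mkseq -sum1_count -sum1_card.
rewrite -[iota 0 k]/(index_iota 0 k) -[in LHS](subn0 k) big_mkord.
by apply: eq_bigl => i; rewrite !inE nth_mkseq // eqbF_neg.
Qed.

Lemma mem_zeros i : (i \in zeros (word k t)) = (i < k) && ~~ bit t i.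
Proof.
rewrite /zeros mem_filter mem_iota /word size_mkseq leq0n add0n andTb andbC.
have [lt_i | //] := ltnP i k.
by rewrite nth_mkseq // eqbF_neg.
Qed.

Lemma nth_rot_word n a : n <= k -> a < k ->
  nth true (rot n (word k t)) a = bit t ((n + a) %% k).
Proof.
move=> le_n lt_a; rewrite /rot nth_cat size_drop size_mkseq.
case: ltnP => [lt | le].
  have lt_na : n + a < k by move: lt; lia.
  by rewrite nth_drop nth_mkseq // modn_small.
rewrite nth_take; last by move: lt_a le; lia.
rewrite nth_mkseq; last by move: lt_a le le_n; lia.
congr (bit t _); rewrite -[in RHS](subnK (_ : k <= n + a)) ?modnDr ?modn_small;
  by move: lt_a le le_n; lia.
Qed.

Lemma val_dist (v x : I) : x = (v.+1 + dist v x) %% k :> nat.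
Proof.
have e : x = (v + 1 + (x - v - 1) :> I)%R by ring.
rewrite {1}e; change (((v + 1 %% k) %% k + dist v x) %% k = (v.+1 + dist v x) %% k).
by rewrite modnDml (modn_small (_ : 1 < k)) // addn1.
Qed.

(** All letters before the first [false] are [true], so the count in [gap] is the index of that
    [false], and the index in the rotated word is [dist v]. *)
Lemma gap_ge (v : I) m : m <= k ->
  v \notin T -> (m <= gap (word k t) v) = (window v m \subset T).
Proof.
move=> le_m nv; rewrite /gap; set s := rot _ _.
have sz_s : size s = k by rewrite size_rot size_mkseq.
have nth_s x : nth true s (dist v x) = (x \in T).
  by rewrite nth_rot_word ?dist_lt // -val_dist inE.
have cntE : count_mem true (take (index false s) s) = index false s.
  have sz : size (take (index false s) s) = index false s.
    by rewrite size_takel // index_size.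
  rewrite -[RHS]sz; apply/eqP; rewrite -all_count; apply/(all_nthP true) => i.
  rewrite sz => lt_i; rewrite nth_take //= eqb_id.
  by have := before_find true lt_i; rewrite /= eqbF_neg => /negbFE.
rewrite cntE; apply/idP/subsetP => [le_mi x | sub].
  rewrite inE => lt_x; rewrite -nth_s.
  by have := before_find true (leq_trans lt_x le_mi); rewrite /= eqbF_neg => /negbFE.
rewrite leqNgt; apply/negP => lt_i.
have [x dx] := dist_surj v (leq_trans lt_i le_m).
have fs : false \in s by rewrite -index_mem sz_s (leq_trans lt_i).
by have := sub x; rewrite inE dx -nth_s dx nth_index // => /(_ lt_i).
Qed.

Lemma long_gapsP : long_gaps T <->
  (forall g, g \in gaps (word k t) -> size (zeros (word k t)) - 1 <= g).
Proof.
have le_m : size (zeros (word k t)) - 1 <= k.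
  by rewrite size_zeros (leq_trans (leq_subr _ _)) // -[leqRHS]card_ord max_card.
split=> [lg _ /mapP[i zi ->] | lg v nv].
  have /andP[lt_i ni] : (i < k) && ~~ bit t i by rewrite -mem_zeros.
  have nv : Ordinal lt_i \notin T by rewrite inE.
  by rewrite -[i]/(val (Ordinal lt_i)) gap_ge // size_zeros subn1 lg.
rewrite -subn1 -size_zeros -gap_ge //; apply: lg; apply: map_f.
by rewrite mem_zeros ltn_ord; move: nv; rewrite inE.
Qed.

End Link.

Theorem theorem1p1 (k t : nat) (hk : 2 <= k) (ht1 : 1 <= t)
    (ht2 : t < 2 ^ k - 1) :
  #|Stk t k| = 2 ^ (k - 1) <->
  (forall g : nat, g \in gaps (word k t) -> size (zeros (word k t)) - 1 <= g).
Proof.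
case: k hk ht2 => [//|[//|p]] _ ht2.
rewrite -(long_gapsP ht1 ht2).
rewrite -(heavy_long_gaps (bits_neq0 ht1 ht2) (bits_neqT ht2)).
rewrite (card_Stk ht1 ht2) subn1 /=.
have := expn_gt0 2 p.+1; lia.
Qed.
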